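(* Let $K$ be a convex set in $\mathbb{R}^n$. Suppose that $c\colon K\times K\to\mathbb{R}$ is a continuous function. Let $x\in K$ and let $f$ be a continuous function on $K$. The following conditions are equivalent: (i) for all $x_1,\dotsc,x_{n+1}\in K$ and all non-negative $\lambda_1,\dotsc,\lambda_{n+1}$ that sum up to one and such that $x=\sum_{i=1}^{n+1}\lambda_ix_i$ there is $$f(x)- \sum_{i=1}^{n+1}\lambda_i f(x_i)\leq\sum_{i=1}^{n+1}\lambda_ic\Big(\sum_{j=1}^{n+1}\lambda_jx_j,x_i\Big);$$ (ii) there exists $\gamma\in\mathbb{R}^n$ such that for all $y\in K$ in the minimal face of $K$ that contains $x$ we have $$f(x)-f(y)\leq c(x,y)+\langle \gamma, y-x\rangle;$$ (iii) for any bounded random variable $X$ with values in $K$ and barycentre $x$ there is $$\mathbb{E}\big( f(x)-f(X)\big)\leq \mathbb{E}c(x,X).$$ Moreover, suppose that $K$ is open and additionally that for any $x_0\in K$ there exists an open, convex set $K'\subset K$ such that $x_0\in K'$ and $|c(x,y)|\leq\Lambda \|x-y\|$ for all $x,y\in K'$ and some constant $\Lambda$, and that $c$ is locally Lipschitz in the second variable. Suppose that $f\colon K\to\mathbb{R}$ (not assumed continuous) satisfies one of the conditions (i), (ii), (iii) for each $x\in K$. Then it satisfies all the other conditions for each $x\in K$. In such case, any function that satisfies these conditions is locally Lipschitz.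
   Context: A set $F\subset K$ is a face of $K$ if for any $z\in F$ and any $t\in(0,1)$ such that $z=tx+(1-t)y$ for some $x,y\in K$ we have $x,y\in F$. For each $x\in K$ there is a unique minimal face of $K$ containing $x$ (the intersection of all faces containing $x$). A random variable $X$ has barycentre $x$ if $\mathbb{E}X=x$. *)

(* Defs.v *)
From HB Require Import structures.
From mathcomp Require Import all_boot all_order all_algebra.
From mathcomp Require Import all_classical all_reals all_analysis.

Set Implicit Arguments.
Unset Strict Implicit.
Unset Printing Implicit Defensive.

Import Order.TTheory GRing.Theory Num.Theory.
Import numFieldNormedType.Exports.

Local Open Scope classical_set_scope.
Local Open Scope ring_scope.

Definition dot (R : realType) (n : nat) (u v : 'rV[R]_n) : R :=
  \sum_(i < n) u 0 i * v 0 i.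

(* The norm of the library on ['rV[R]_n] is the sup norm; it induces the same
   topology. *)
Definition enorm (R : realType) (n : nat) (v : 'rV[R]_n) : R :=
  Num.sqrt (dot v v).

Definition locally_lipschitz (R : realType) (n : nat) (A : set 'rV[R]_n)
    (f : 'rV[R]_n -> R) : Prop :=
  forall x, A x -> exists (U : set 'rV[R]_n) (L : R), nbhs x U /\
    forall y z, A y -> A z -> U y -> U z -> `|f y - f z| <= L * enorm (y - z).

(* Faces are not required to be convex or nonempty. *)
Definition face (R : realType) (n : nat) (K F : set 'rV[R]_n) : Prop :=
  F `<=` K /\
  forall (x y z : 'rV[R]_n) (t : R), F z -> K x -> K y -> 0 < t -> t < 1 ->
    z = t *: x + (1 - t) *: y -> F x /\ F y.

Definition minimal_face (R : realType) (n : nat) (K : set 'rV[R]_n)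
    (x : 'rV[R]_n) : set 'rV[R]_n :=
  \bigcap_(F in [set F | face K F /\ F x]) F.

Notation borel_rV R n := (g_sigma_algebraType (@open 'rV[R]_n)).

Definition has_barycentre (R : realType) (n : nat) (d : measure_display)
    (T : measurableType d) (P : probability T R) (X : T -> 'rV[R]_n)
    (x : 'rV[R]_n) : Prop :=
  forall i : 'I_n, ('E_P[fun w => X w 0%R i] = (x 0%R i)%:E)%E.

(* The expectation of [Y] is meaningful in [-oo, +oo]: [Y] is measurable and
   its positive and negative parts do not both have infinite expectation. *)
Definition expectation_defined (R : realType) (d : measure_display)
    (T : measurableType d) (P : probability T R) (Y : T -> R) : Prop :=
  measurable_fun setT Y /\ ('E_P[Y^\+] < +oo \/ 'E_P[Y^\-] < +oo)%E.

Section conditions.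
Context (R : realType) (n : nat) (K : set 'rV[R]_n).
Context (c : 'rV[R]_n -> 'rV[R]_n -> R) (f : 'rV[R]_n -> R) (x : 'rV[R]_n).

Definition finite_jensen : Prop :=
  forall (xs : 'I_n.+1 -> 'rV[R]_n) (lam : 'I_n.+1 -> R),
    (forall i, K (xs i)) -> (forall i, 0 <= lam i) ->
    \sum_i lam i = 1 -> x = \sum_i lam i *: xs i ->
    f x - \sum_i lam i * f (xs i)
      <= \sum_i lam i * c (\sum_j lam j *: xs j) (xs i).

Definition face_supporting : Prop :=
  exists gamma : 'rV[R]_n, forall y, K y -> minimal_face K x y ->
    f x - f y <= c x y + dot gamma (y - x).

(* A bounded [X] may approach points of the boundary that are not in [K], so
   the continuous functions [f] and [c x] need not be bounded along [X]; and
   [f] is not always assumed measurable. The inequality, in [-oo, +oo], is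
   required whenever its two sides are meaningful. *)
Definition random_jensen : Prop :=
  forall (d : measure_display) (T : measurableType d) (P : probability T R)
    (X : {RV P >-> borel_rV R n}),
    (exists M : R, forall w, enorm (X w : 'rV[R]_n) <= M) ->
    (forall w, K (X w)) -> has_barycentre P X x ->
    expectation_defined P (fun w => f x - f (X w)) ->
    expectation_defined P (fun w => c x (X w)) ->
    ('E_P[fun w => (f x - f (X w))%R] <= 'E_P[fun w => c x (X w)])%E.

End conditions.

(* Main.v *)
Require Import Defs.
From HB Require Import structures.
From mathcomp Require Import all_boot all_order all_algebra.
From mathcomp Require Import all_classical all_reals all_analysis.
From mathcomp Require Import measurable_realfun ring lra.

(* Put [g y = f x - f y - c x y]; all three conditions say that the upper concave
   envelope of [g] is nonpositive at [x].
   The minimal face of [x] consists of the [y] in [K] such that the segment from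
   [y] to [x] can be prolonged beyond [x] inside [K]. On that face Caratheodory
   and a Hahn-Banach argument turn (i) into the affine majorant of [g] in (ii).
   A random variable in [K] with barycentre [x] lies almost surely in the minimal
   face, so integrating (ii) gives (iii); (i) is (iii) for finitely supported laws.
   For [K] open, the minimal face is [K]. Near [x0], (ii) at [x], tested at a
   vertex [y] of a fixed cube with [<gamma, y - x> <= 0], bounds [f x] from above,
   and (ii) at [x0] bounds it from below; these bounds control [gamma], and then
   (ii) is a local Lipschitz estimate. *)

Set Implicit Arguments.
Unset Strict Implicit.
Unset Printing Implicit Defensive.

Import Order.TTheory GRing.Theory Num.Theory.
Import numFieldNormedType.Exports.

Local Open Scope classical_set_scope.
Local Open Scope ring_scope.

(** * Bilinearity of the dot product *)

Section dot_theory.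
Context (R : realType) (n : nat).
Implicit Types (u v w : 'rV[R]_n) (a : R).

Lemma dotC u v : dot u v = dot v u.
Proof. by apply: eq_bigr => i _; rewrite mulrC. Qed.

Lemma dotDr u v w : dot u (v + w) = dot u v + dot u w.
Proof. by rewrite -big_split; apply: eq_bigr => i _; rewrite mxE mulrDr. Qed.

Lemma dotZr u a v : dot u (a *: v) = a * dot u v.
Proof. by rewrite [RHS]big_distrr; apply: eq_bigr => i _; rewrite mxE mulrCA. Qed.

Lemma dotNr u v : dot u (- v) = - dot u v.
Proof. by rewrite -scaleN1r dotZr mulN1r. Qed.

Lemma dot0r u : dot u 0 = 0.
Proof. by rewrite -(scale0r 0) dotZr mul0r. Qed.

Lemma dotDl u v w : dot (u + v) w = dot u w + dot v w.
Proof. by rewrite !(dotC _ w) dotDr. Qed.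

Lemma dotZl a u v : dot (a *: u) v = a * dot u v.
Proof. by rewrite !(dotC _ v) dotZr. Qed.

Lemma dotNl u v : dot (- u) v = - dot u v.
Proof. by rewrite !(dotC _ v) dotNr. Qed.

Lemma dot_delta (i : 'I_n) v : dot (delta_mx 0 i) v = v 0 i.
Proof.
rewrite /dot (bigD1 i)//= mxE !eqxx mul1r big1 ?addr0// => j ji.
by rewrite mxE (negbTE ji) andbF mul0r.
Qed.

End dot_theory.

(** * Supporting functionals of convex cones *)

Section cones.
Context (R : realType) (n : nat).
Implicit Types (u v w : 'rV[R]_n) (a s t : R).

(* Hahn-Banach, one coordinate at a time: the cone condition at the coordinate
   [k] says that every lower bound for the value of [gamma] there is at most
   every upper bound. *)
Lemma cone_supporting (C : 'rV[R]_n -> R -> Prop) :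
  (forall v s w t, C v s -> C w t -> C (v + w) (s + t)) ->
  (forall a v s, 0 < a -> C v s -> C (a *: v) (a * s)) ->
  (forall v s, C v s -> exists t, C (- v) t) ->
  (forall s, C 0 s -> s <= 0) ->
  exists gamma, forall v s, C v s -> s <= dot gamma v.
Proof.
move=> CD CZ CN C0.
suff H k : (k <= n)%N -> exists gamma, forall v s, C v s ->
    (forall i : 'I_n, (k <= i)%N -> v 0 i = 0) -> s <= dot gamma v.
  have [g Hg] := H n (leqnn _); exists g => v s Cvs.
  by apply: Hg => // i; rewrite leqNgt ltn_ord.
elim: k => [_|k IH kn].
  exists 0 => v s Cvs v0; have vE : v = 0 by apply/rowP => i; rewrite v0 ?mxE.
  by rewrite vE dot0r; apply: C0; rewrite -vE.
have [g Hg] := IH (ltnW kn); pose i0 := Ordinal kn.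
pose sl v := forall i : 'I_n, (k < i)%N -> v 0 i = 0.
have sl0 v : sl v -> v 0 i0 = 0 -> forall i : 'I_n, (k <= i)%N -> v 0 i = 0.
  move=> slv v0 i; rewrite leq_eqVlt => /predU1P[ki|/slv//].
  by rewrite -v0; congr (v 0 _); exact/val_inj.
have slN v : sl v -> sl (- v) by move=> slv i /slv vi; rewrite mxE vi oppr0.
(* The positive combination with weights [- w 0 i0] and [v 0 i0] cancels the coordinate [k], so the
   bound by [g] from the induction applies to it. *)
have cross v s w t : C v s -> C w t -> sl v -> sl w ->
    0 < v 0 i0 -> w 0 i0 < 0 ->
    (s - dot g v) / v 0 i0 <= (t - dot g w) / w 0 i0.
  move=> Cvs Cwt slv slw v0 w0.
  have := Hg _ _ (CD _ _ _ _ (CZ (- w 0 i0) _ _ _ Cvs) (CZ (v 0 i0) _ _ v0 Cwt)).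
  rewrite oppr_gt0 dotDr !dotZr => /(_ w0) H.
  rewrite ler_pdivrMr// mulrAC ler_ndivlMr//.
  suff : - w 0 i0 * s + v 0 i0 * t <= - w 0 i0 * dot g v + v 0 i0 * dot g w.
    by move=> ?; lra.
  apply: H; apply: sl0 => [i ki|]; rewrite !mxE; last by ring.
  by rewrite (slv i)// (slw i)// !mulr0 addr0.
pose S := [set r | exists v s, [/\ C v s, sl v, 0 < v 0 i0 &
  r = (s - dot g v) / v 0 i0]].
(* [CN] supplies a vector of opposite sign at [k]: it shows [S] nonempty when [v 0 i0 < 0] and
   bounded above when [v 0 i0 > 0]. *)
exists (g + sup S *: delta_mx 0 i0) => v s Cvs slv.
rewrite dotDl dotZl dot_delta -lerBlDl.
have [t CNv] := CN _ _ Cvs.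
have [v0|v0|v0] := ltrgtP (v 0 i0) 0.
- rewrite -ler_ndivlMr//; apply: ge_sup.
    exists ((t - dot g (- v)) / (- v) 0 i0), (- v), t.
    by split=> //; [exact: slN|rewrite mxE oppr_gt0].
  by move=> _ [w [r [Cwr slw w0 ->]]]; exact: cross.
- rewrite -ler_pdivrMr//; apply: ub_le_sup; last by exists v, s.
  exists ((t - dot g (- v)) / (- v) 0 i0) => _ [w [r [Cwr slw w0 ->]]].
  by apply: cross => //; [exact: slN|rewrite mxE oppr_lt0].
- by rewrite v0 mulr0 subr_le0; apply: Hg => //; exact: sl0.
Qed.

Let mask (k : nat) v : 'rV[R]_n := \row_i (if (i < k)%N then v 0 i else 0).

Let maskD k v w : mask k (v + w) = mask k v + mask k w.
Proof. by apply/rowP => i; rewrite !mxE; case: ifP; rewrite ?addr0. Qed.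

Let maskZ k a v : mask k (a *: v) = a *: mask k v.
Proof. by apply/rowP => i; rewrite !mxE; case: ifP; rewrite ?mulr0. Qed.

Let dot_mask k u v : dot (mask k u) v = dot u (mask k v).
Proof.
by apply: eq_bigr => i _; rewrite !mxE; case: ifP; rewrite ?mulr0 ?mul0r.
Qed.

Let maskS k (kn : (k < n)%N) v :
  mask k.+1 v = mask k v + v 0 (Ordinal kn) *: delta_mx 0 (Ordinal kn).
Proof.
apply/rowP => i; rewrite !mxE eqxx ltnS leq_eqVlt /=.
have [ik|ik] := eqVneq (i : nat) k.
  have -> : i = Ordinal kn by exact/val_inj.
  by rewrite /= eqxx ltnn mulr1 add0r.
have -> : (i == Ordinal kn) = false by apply/negbTE; apply: contra ik => /eqP ->.
by rewrite mulr0 addr0.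
Qed.

(* Restrict to the longest prefix of the coordinates in which the image of [D]
   is symmetric; one coordinate further, the image is supported by
   [cone_supporting], and the support is not the whole image. *)
Lemma cone_symmetric_or_supported (D : set 'rV[R]_n) :
  (forall v w, D v -> D w -> D (v + w)) ->
  (forall a v, 0 < a -> D v -> D (a *: v)) ->
  (forall v, D v -> D (- v)) \/
  exists l, (forall v, D v -> 0 <= dot l v) /\ exists2 v, D v & 0 < dot l v.
Proof.
move=> DD DZ.
have [?|noL] := pselect (exists l, (forall v, D v -> 0 <= dot l v) /\
  exists2 v, D v & 0 < dot l v); [by right|left].
pose P k := forall v, D v -> exists2 w, D w & mask k w = - mask k v.
(* Under the sign condition, [cone_supporting] bounds [sg] times the coordinate [k] by a functional
   of the earlier coordinates. By [noL] this bound is an equality on [D], so the symmetry extends to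
   the coordinate [k]. *)
have supported k (kn : (k < n)%N) sg : sg != 0 -> P k ->
    (forall p, D p -> mask k p = 0 -> sg * p 0 (Ordinal kn) <= 0) -> P k.+1.
  move=> sg0 Pk H; pose i0 := Ordinal kn.
  have [||||g Hg] := @cone_supporting (fun v s =>
    exists2 u, D u & v = mask k u /\ s = sg * u 0 i0).
  - move=> ? ? ? ? [u Du [-> ->]] [v Dv [-> ->]]; exists (u + v); first exact: DD.
    by rewrite maskD mxE mulrDr.
  - move=> a ? ? a0 [u Du [-> ->]]; exists (a *: u); first exact: DZ.
    by rewrite maskZ mxE mulrCA.
  - move=> ? ? [u Du [-> _]]; have [w Dw wE] := Pk _ Du.
    by exists (sg * w 0 i0), w.
  - by move=> ? [u Du [/esym u0 ->]]; exact: H.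
  have lE u : dot (mask k g - sg *: delta_mx 0 i0) u =
      dot g (mask k u) - sg * u 0 i0.
    by rewrite dotDl dotNl dotZl dot_delta dot_mask.
  have key u : D u -> dot g (mask k u) = sg * u 0 i0.
    move=> Du; apply/eqP; rewrite eq_le -subr_le0 -lE Hg ?andbT; last by exists u.
    rewrite leNgt; apply/negP => u0; apply: noL.
    exists (mask k g - sg *: delta_mx 0 i0); split; last by exists u.
    by move=> v Dv; rewrite lE subr_ge0; apply: Hg; exists v.
  move=> v Dv; have [w Dw wE] := Pk _ Dv; exists w => //.
  rewrite !(maskS kn) wE opprD -scaleNr; congr (_ + _ *: _).
  apply: (mulfI sg0); rewrite -key// wE dotNr key// mulrN //.
have PS k : (k < n)%N -> P k -> P k.+1.
  move=> kn Pk; pose i0 := Ordinal kn.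
  have [H|/existsNP[p /not_implyP[Dp /not_implyP[p0 /negP]]]] :=
    pselect (forall p, D p -> mask k p = 0 -> 1 * p 0 i0 <= 0).
    exact: (@supported k kn 1).
  rewrite mul1r -ltNge => pi0.
  have [H|/existsNP[q /not_implyP[Dq /not_implyP[q0 /negP]]]] :=
    pselect (forall p, D p -> mask k p = 0 -> -1 * p 0 i0 <= 0).
    by apply: (@supported k kn (-1)) => //; rewrite oppr_eq0 oner_eq0.
  rewrite mulN1r -ltNge oppr_gt0 => qi0.
  move=> v Dv; have [w Dw wE] := Pk _ Dv.
  (* [p] and [q] vanish before [k] and have opposite signs there: adding a positive multiple of one
     of them corrects the coordinate [k] of [w] and leaves the earlier ones alone. *)
  suff [w' Dw' [w'E w'0]] : exists2 w', D w' &
      mask k w' = mask k w /\ w' 0 i0 = - v 0 i0.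
    by exists w' => //; rewrite !(maskS kn) w'E wE w'0 opprD scaleNr.
  have [r0|r0|r0] := ltrgtP (- v 0 i0) (w 0 i0).
  - exists (w + ((- v 0 i0 - w 0 i0) / q 0 i0) *: q).
      apply: DD => //; apply: DZ => //.
      by rewrite nmulr_lgt0 ?invr_lt0// subr_lt0.
    by rewrite maskD maskZ q0 scaler0 addr0 !mxE divfK ?lt_eqF//; split=> //; ring.
  - exists (w + ((- v 0 i0 - w 0 i0) / p 0 i0) *: p).
      by apply: DD => //; apply: DZ => //; rewrite divr_gt0// subr_gt0.
    by rewrite maskD maskZ p0 scaler0 addr0 !mxE divfK ?gt_eqF//; split=> //; ring.
  - by exists w.
have Pn k : (k <= n)%N -> P k.
  elim: k => [_ v Dv|k IH kn]; last exact/PS/IH/ltnW.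
  by exists v => //; apply/rowP => i; rewrite !mxE oppr0.
have maskn v : mask n v = v by apply/rowP => i; rewrite mxE ltn_ord.
by move=> v Dv; have [w Dw] := Pn n (leqnn _) v Dv; rewrite !maskn => <-.
Qed.

End cones.

(** * Caratheodory reduction of the number of points *)

Section jensen.
Context (R : realType) (n : nat).
Implicit Types (K : set 'rV[R]_n) (g : 'rV[R]_n -> R) (x y : 'rV[R]_n).

(** Condition (i) in terms of [g], with the number of points left free so that it can be raised and
    lowered. *)
Definition jensen_le0 K g x (m : nat) : Prop :=
  forall (xs : 'I_m -> 'rV[R]_n) (lam : 'I_m -> R),
    (forall i, K (xs i)) -> (forall i, 0 <= lam i) ->
    \sum_i lam i = 1 -> x = \sum_i lam i *: xs i ->
    \sum_i lam i * g (xs i) <= 0.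

(** A combination is padded with [x] itself, at weight zero. *)
Lemma jensen_le0_weaken K g x m :
  K x -> jensen_le0 K g x m.+1 -> jensen_le0 K g x m.
Proof.
move=> Kx H xs lam Kxs lam0 lam1 xE.
have := H (fun i => if unlift ord0 i is Some j then xs j else x)
  (fun i => if unlift ord0 i is Some j then lam j else 0).
rewrite !big_ord_recl !unlift_none scale0r !mul0r !add0r.
under eq_bigr do rewrite liftK.
under [X in x = X]eq_bigr do rewrite liftK.
under [X in X <= 0]eq_bigr do rewrite liftK.
by apply=> // i; case: (unlift ord0 i).
Qed.

(* Caratheodory: moving the weights along an affine dependence of the points, in
   the direction in which the sum does not decrease, makes one of them vanish. *)
Lemma jensen_le0_caratheodory K g x m :
  (n < m)%N -> jensen_le0 K g x m -> jensen_le0 K g x m.+1.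
Proof.
move=> nm H xs lam Kxs lam0 lam1 xE.
(* More rows than columns, so a nonzero [u] satisfies [u *m A = 0]; the column of ones makes its
   entries sum to zero, which gives an affine dependence. *)
pose A : 'M[R]_(m.+1, n + 1) := row_mx (\matrix_i xs i) (const_mx 1).
have [u /sub_kermxP uA u0] : exists2 u : 'rV_m.+1, (u <= kermx A)%MS & u != 0.
  apply/rowV0Pn; rewrite kermx_eq0; apply/negP => /eqP rA.
  by have := rank_leq_col A; rewrite rA addn1 leqNgt ltnS nm.
have /andP[/eqP uxs /eqP u1] : (u *m \matrix_i xs i == 0) &&
    (u *m (const_mx 1 : 'cV_m.+1) == 0).
  by rewrite -row_mx_eq0 -mul_mx_row uA.
have {}uxs : \sum_i u 0 i *: xs i = 0.
  by move: uxs; rewrite mulmx_sum_row; under eq_bigr do rewrite rowK.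
have {}u1 : \sum_i u 0 i = 0.
  have /rowP/(_ 0) := u1; rewrite !mxE => {2}<-.
  by apply: eq_bigr => i _; rewrite !mxE mulr1.
have [mu [mu0 muxs mu1 mug]] : exists mu : 'I_m.+1 -> R,
    [/\ exists i, mu i != 0, \sum_i mu i *: xs i = 0, \sum_i mu i = 0 &
        0 <= \sum_i mu i * g (xs i)].
  have [i ui] : exists i, u 0 i != 0.
    apply/existsP; rewrite -negb_forall; apply: contra u0 => /forallP u0.
    by apply/eqP/rowP => i; rewrite mxE; exact/eqP.
  have [ug|/ltW ug] := leP 0 (\sum_i u 0 i * g (xs i)).
    by exists (u 0); split=> //; exists i.
  exists (fun i => - u 0 i); split.
  - by exists i; rewrite oppr_eq0.
  - by under eq_bigr do rewrite scaleNr; rewrite sumrN uxs oppr0.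
  - by rewrite sumrN u1 oppr0.
  - by under eq_bigr do rewrite mulNr; rewrite sumrN oppr_ge0.
have [i0 i0_lt0] : exists i, mu i < 0.
  apply/existsP; rewrite -[X in is_true X]negbK negb_exists; apply/negP.
  move=> /forallP mu_ge0; case: mu0 => i /negP; apply.
  have /eqP : \sum_i mu i == 0 by rewrite mu1.
  by move/psumr_eq0P => -> // j _; rewrite leNgt.
(* The smallest ratio is the largest [t] that keeps all [lam i + t * mu i] nonnegative; the weight
   at [i1] then vanishes. *)
have [i1 i1_lt0 i1_min] :=
  @arg_minP _ _ _ i0 (fun i => mu i < 0) (fun i => lam i / - mu i) i0_lt0.
pose t := lam i1 / - mu i1.
have t0 : 0 <= t by rewrite divr_ge0// oppr_ge0 ltW.
pose lam' i := lam i + t * mu i.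
have lam'i1 : lam' i1 = 0.
  by rewrite /lam' /t invrN mulrN mulNr divfK ?subrr// lt_eqF.
have lam'1 : \sum_i lam' i = 1.
  by rewrite big_split/= -mulr_sumr mu1 mulr0 addr0.
have lam'x : x = \sum_i lam' i *: xs i.
  under eq_bigr do rewrite scalerDl -scalerA.
  by rewrite big_split/= -scaler_sumr muxs scaler0 addr0.
apply: (@le_trans _ _ (\sum_i lam' i * g (xs i))).
  under [leRHS]eq_bigr do rewrite mulrDl -mulrA.
  by rewrite big_split/= -mulr_sumr lerDl mulr_ge0.
rewrite (bigD1_ord i1)//= lam'i1 mul0r add0r; apply: H => //.
- move=> i; rewrite /lam'; have [mui|mui] := leP 0 (mu (lift i1 i)).
    by rewrite addr_ge0// mulr_ge0.
  have := i1_min _ mui; rewrite -/t ler_pdivlMr ?oppr_gt0// mulrN.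
  by rewrite -subr_ge0 opprK.
- by rewrite -lam'1 [RHS](bigD1_ord i1)//= lam'i1 add0r.
- by rewrite lam'x (bigD1_ord i1)//= lam'i1 scale0r add0r.
Qed.

(** Caratheodory raises the number of points from [n.+1] to [n.+1 + m], and padding lowers it to
    [m]. *)
Lemma jensen_le0_all K g x m :
  K x -> jensen_le0 K g x n.+1 -> jensen_le0 K g x m.
Proof.
move=> Kx H; have up k : jensen_le0 K g x (n.+1 + k).
  elim: k => [|k IH]; first by rewrite addn0.
  by rewrite addnS; apply: jensen_le0_caratheodory => //; rewrite addSn ltnS leq_addr.
have down k : jensen_le0 K g x (m + k) -> jensen_le0 K g x m.
  elim: k => [|k IH]; first by rewrite addn0.
  by rewrite addnS => /(jensen_le0_weaken Kx).
by apply: (down n.+1); rewrite addnC.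
Qed.

End jensen.

(** * The minimal face, and (i) implies (ii) *)

Section minimal_faces.
Context (R : realType) (n : nat) (K : set 'rV[R]_n) (Kconvex : convex_set K).
Implicit Types (x y v w : 'rV[R]_n).

Lemma convex_set_combination x y (t : R) : K x -> K y -> 0 <= t -> t <= 1 ->
  K (t *: x + (1 - t) *: y).
Proof.
move=> Kx Ky t0 t1.
by have := @Kconvex x y (Itv01 t0 t1); rewrite !inE; exact.
Qed.

(** The set on the right is itself a face through [x]; conversely [x] lies strictly between [y] and
    the prolonged point, so every face through [x] contains [y]. *)
Lemma minimal_faceP x y : K x ->
  minimal_face K x y <-> K y /\ exists2 e, 0 < e & K (x - e *: (y - x)).
Proof.
move=> Kx; split=> [yF|[Ky [e e0 Kz]] F [[_ faceF] Fx]]; last first.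
  have e1 : 0 < 1 + e by rewrite ltr_wpDl.
  apply: (faceF y _ x (e / (1 + e)) Fx Ky Kz _ _ _).1.
  - by rewrite divr_gt0.
  - by rewrite ltr_pdivrMr// mul1r ltrDr.
  - by apply/rowP => i; rewrite !mxE; field; rewrite gt_eqF.
apply: (yF [set y | K y /\ exists2 e, 0 < e & K (x - e *: (y - x))]).
split; last first.
  by split=> //; exists 1 => //; rewrite subrr scaler0 subr0.
split=> [z []//|a b z t [Kz [e e0 Kw]] Ka Kb t0 t1 zE].
(* Mixing the prolonged point of [z] with [q], in the proportion that cancels [q], prolongs the
   segment from [p] to [x]. *)
have side p q s : K p -> K q -> 0 < s -> s < 1 -> z = s *: p + (1 - s) *: q ->
    exists2 e, 0 < e & K (x - e *: (p - x)).
  move=> Kp Kq s0 s1 {}zE; have d0 : 0 < 1 + e * (1 - s).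
    by rewrite ltr_wpDr// mulr_ge0 ?subr_ge0 ?ltW.
  exists (e * s / (1 + e * (1 - s))); first by rewrite divr_gt0 ?mulr_gt0.
  have -> : x - (e * s / (1 + e * (1 - s))) *: (p - x) =
      (1 + e * (1 - s))^-1 *: (x - e *: (z - x)) +
      (1 - (1 + e * (1 - s))^-1) *: q.
    by rewrite zE; apply/rowP => i; rewrite !mxE; field; rewrite gt_eqF.
  apply: convex_set_combination => //; first by rewrite invr_ge0 ltW.
  by rewrite invf_le1// lerDl mulr_ge0 ?subr_ge0 ?ltW.
split; split=> //; first exact: (side a b t).
apply: (side b a (1 - t)) => //; rewrite ?subr_gt0 ?gtrBl//.
by rewrite zE addrC opprB addrCA subrr addr0.
Qed.

(** [cone_supporting] is applied to the cone generated by the pairs [(y - x, g y)] with [y] in the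
    minimal face, its elements being presented by lists of weighted points. *)
Lemma face_supporting_of_finite_jensen c f x :
  K x -> finite_jensen K c f x -> face_supporting K c f x.
Proof.
move=> Kx fin; pose g y := f x - f y - c x y.
have jen m : jensen_le0 K g x m.
  apply: jensen_le0_all => // xs lam Kxs lam0 lam1 xE.
  have := fin xs lam Kxs lam0 lam1 xE; rewrite -xE -subr_le0.
  congr (_ <= _); under [RHS]eq_bigr do rewrite !mulrBr.
  by rewrite !sumrB -mulr_suml lam1 mul1r.
pose G y := minimal_face K x y.
pose ev (s : seq (R * 'rV[R]_n)) := \sum_(p <- s) p.1 *: (p.2 - x).
pose eg (s : seq (R * 'rV[R]_n)) := \sum_(p <- s) p.1 * g p.2.
pose ok (s : seq (R * 'rV[R]_n)) := forall p, p \in s -> 0 <= p.1 /\ G p.2.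
have okc p s : ok (p :: s) -> [/\ 0 <= p.1, G p.2 & ok s].
  move=> H; have [? ?] := H p (mem_head _ _); split=> // q qs.
  by apply: H; rewrite inE qs orbT.
have okc' p s : 0 <= p.1 -> G p.2 -> ok s -> ok (p :: s).
  by move=> p1 p2 oks q; rewrite inE => /predU1P[->//|/oks].
have [||||gam Hgam] := @cone_supporting _ _ (fun v r =>
    exists2 s, ok s & v = ev s /\ r = eg s).
- move=> ? ? ? ? [s oks [-> ->]] [t okt [-> ->]]; exists (s ++ t).
    by move=> p; rewrite mem_cat => /orP[/oks|/okt].
  by rewrite /ev /eg !big_cat.
- move=> a ? ? a0 [s oks [-> ->]]; exists [seq (a * p.1, p.2) | p <- s].
    move=> _ /mapP[p /oks[p1 p2] ->]; split=> //=.
    by rewrite mulr_ge0// ltW.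
  rewrite /ev /eg !big_map/= scaler_sumr mulr_sumr; split; apply: eq_bigr => p _.
    by rewrite scalerA.
  by rewrite mulrA.
- move=> ? ? [s oks [-> _]].
  suff [t okt tE] : exists2 t, ok t & ev t = - ev s by exists (eg t), t.
  elim: s oks => [|[a y] s IH]; first by exists [::]; rewrite // /ev !big_nil oppr0.
  move=> /okc[/= a0 Gy /IH[t okt tE]].
  have [Ky [e e0 Kz]] := (minimal_faceP _ Kx).1 Gy.
  (* With weight [a / e], the prolonged point contributes the opposite of [a *: (y - x)]; it is in
     the minimal face because [y] prolongs its segment to [x]. *)
  exists ((a / e, x - e *: (y - x)) :: t); last first.
    rewrite /ev !big_cons -/(ev t) -/(ev s) tE opprD/=; congr (_ + _).
    by apply/rowP => i; rewrite !mxE; field; rewrite gt_eqF.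
  apply: okc' => //=; first by rewrite divr_ge0// ltW.
  apply/minimal_faceP => //; split=> //; exists e^-1; first by rewrite invr_gt0.
  suff -> : x - e^-1 *: (x - e *: (y - x) - x) = y by [].
  by apply/rowP => i; rewrite !mxE; field; rewrite gt_eqF.
- move=> r [s oks [v0 ->]].
  (* If the vector is zero and [T] is positive, dividing the weights by [T] writes [x] as a convex
     combination of the listed points, and [jen] applies. *)
  pose T := \sum_(p <- s) p.1.
  have T0 : 0 <= T by rewrite /T big_seq; apply: sumr_ge0 => p /oks[].
  have [Teq0|Tneq0] := eqVneq T 0.
    rewrite /eg big_seq big1// => p ps.
    suff -> : p.1 = 0 by rewrite mul0r.
    move/eqP : Teq0; rewrite /T big_seq psumr_eq0; last by move=> q /oks[].
    by move/allP => /(_ _ ps) /implyP/(_ ps)/eqP.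
  have Tgt0 : 0 < T by rewrite lt_neqAle eq_sym Tneq0.
  rewrite -(pmulr_rle0 _ (_ : 0 < T^-1)) ?invr_gt0// /eg mulr_sumr.
  under eq_bigr do rewrite mulrA.
  rewrite big_tnth; apply: (jen _ (fun i => (tnth (in_tuple s) i).2)
    (fun i => T^-1 * (tnth (in_tuple s) i).1)).
  + by move=> i; have [_ /(minimal_faceP _ Kx)[]] := oks _ (mem_tnth i (in_tuple s)).
  + move=> i; have [? _] := oks _ (mem_tnth i (in_tuple s)).
    by rewrite mulr_ge0// invr_ge0.
  + by rewrite -mulr_sumr -(big_tnth _ _ _ predT fst) mulVf.
  + rewrite -(big_tnth _ _ _ predT (fun p => (T^-1 * p.1) *: p.2)).
    under eq_bigr do rewrite -scalerA.
    rewrite -scaler_sumr; apply: (scalerI Tneq0); rewrite scalerA divff// scale1r.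
    move/eqP: v0; rewrite eq_sym /ev; under eq_bigr do rewrite scalerBr.
    by rewrite sumrB subr_eq0 -scaler_suml => /eqP.
exists gam => y Ky Gy; rewrite -lerBlDl.
apply: Hgam; exists [:: (1, y)]; last by rewrite /ev /eg !big_seq1 scale1r mul1r.
by apply: okc' => //; exact: ler01.
Qed.

End minimal_faces.

(** * Coordinate boxes and the Euclidean norm *)

Section boxes.
Context (R : realType) (n : nat).
Implicit Types (x v gamma : 'rV[R]_n) (a : R).

Lemma nbhs_boxP x (A : set 'rV[R]_n) :
  nbhs x A <-> exists2 r, 0 < r & forall y, (forall i, `|(y - x) 0 i| <= r) -> A y.
Proof.
split=> [/nbhs_ballP[r /= r0 rA]|[r r0 rA]].
  exists (r / 2); first by rewrite divr_gt0.
  move=> y yx; apply: rA; split=> // i j; rewrite (ord1 i).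
  rewrite -ball_normE /= distrC; have := yx j; rewrite !mxE => /le_lt_trans; apply.
  by rewrite ltr_pdivrMr// mulrDr mulr1 ltrDl.
apply/nbhs_ballP; exists r => // y [_ xy]; apply: rA => i.
by have := xy 0 i; rewrite -ball_normE /= !mxE distrC => /ltW.
Qed.

Lemma enorm_coord v i : `|v 0 i| <= enorm v.
Proof.
rewrite -sqrtr_sqr ler_wsqrtr// /dot (bigD1 i)//= expr2 lerDl.
by apply: sumr_ge0 => j _; rewrite -expr2 sqr_ge0.
Qed.

Lemma enorm_box a v : (forall i, `|v 0 i| <= a) -> enorm v <= Num.sqrt (n%:R * a ^+ 2).
Proof.
move=> va; apply: ler_wsqrtr; apply: (@le_trans _ _ (\sum_(i < n) a ^+ 2)).
  apply: ler_sum => i _; rewrite -expr2 -real_normK ?num_real//.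
  by rewrite lerXn2r ?nnegrE// (le_trans _ (va i)).
by rewrite sumr_const card_ord mulr_natl.
Qed.

Lemma dot_box gamma a v : (forall i, `|v 0 i| <= a) ->
  `|dot gamma v| <= a * \sum_i `|gamma 0 i|.
Proof.
move=> va; rewrite mulr_sumr (le_trans (ler_norm_sum _ _ _))//.
by apply: ler_sum => i _; rewrite normrM mulrC ler_wpM2r.
Qed.

End boxes.

(** * Local Lipschitz bound on an open [K] *)

Section open_convex.
Context (R : realType) (n : nat) (K : set 'rV[R]_n) (Kconvex : convex_set K).
Implicit Types (x y : 'rV[R]_n).

Lemma open_minimal_face x : open K -> K x -> minimal_face K x = K.
Proof.
move=> oK Kx; apply/seteqP; split=> y; first by case/(minimal_faceP Kconvex).
move=> Ky; apply/(minimal_faceP Kconvex) => //; split=> //.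
have /nbhs_boxP[r r0 rK] : nbhs x K by exact: open_nbhs_nbhs.
(* The added one keeps the denominator positive when [y = x]. *)
have d0 : 0 < 1 + enorm (y - x) by rewrite ltr_wpDr// sqrtr_ge0.
exists (r / (1 + enorm (y - x))); first by rewrite divr_gt0.
apply: rK => i; rewrite addrAC subrr add0r mxE mxE normrN normrM.
rewrite gtr0_norm ?divr_gt0// mulrAC ler_pdivrMr// ler_pM2l//.
by rewrite (le_trans (enorm_coord _ _))// lerDr.
Qed.

Lemma locally_lipschitz_of_face_supporting c f :
  open K ->
  (forall x0, K x0 -> exists (U : set 'rV[R]_n) (Lambda : R),
      [/\ nbhs x0 U, U `<=` K &
        forall x y, U x -> U y -> `|c x y| <= Lambda * enorm (x - y)]) ->
  (forall x, K x -> face_supporting K c f x) -> locally_lipschitz K f.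
Proof.
move=> oK cK face x0 Kx0.
have supp x : K x -> exists gamma, forall y, K y ->
    f x - f y <= c x y + dot gamma (y - x).
  move=> Kx; have [g Hg] := face x Kx; exists g => y Ky.
  by apply: Hg => //; rewrite open_minimal_face.
have [K' [L0 [x0K' K'K cL0]]] := cK _ Kx0.
(* [L0] may be negative; the bounds below are monotone in the norm only for a nonnegative
   constant. *)
pose L := `|L0|.
have cL x y : K' x -> K' y -> c x y <= L * enorm (x - y).
  move=> K'x K'y; rewrite (le_trans (ler_norm _))// (le_trans (cL0 _ _ K'x K'y))//.
  by rewrite ler_wpM2r ?sqrtr_ge0// ler_norm.
have /nbhs_boxP[r r0 rK'] := x0K'.
pose box a := [set y : 'rV[R]_n | forall i, `|(y - x0) 0 i| <= a].
pose E := L * Num.sqrt (n%:R * (2 * r) ^+ 2).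
have boxE x y : box r x -> box r y -> c x y <= E.
  move=> bx by_; rewrite (le_trans (cL _ _ (rK' _ bx) (rK' _ by_)))//.
  rewrite ler_wpM2l ?normr_ge0// enorm_box// => i.
  have -> : (x - y) 0 i = (x - x0) 0 i - (y - x0) 0 i by rewrite !mxE; ring.
  by rewrite (le_trans (ler_normB _ _))// mulr_natl mulr2n lerD.
(* Vertices of the unit cube; [sgn g] selects one where [dot g] attains its maximum, the l1 norm of
   [g]. *)
pose sg (s : {ffun 'I_n -> bool}) : 'rV[R]_n := \row_i (-1) ^+ s i.
have sg_box a s i : 0 <= a -> `|(- (a *: sg s)) 0 i| <= a.
  by move=> a0; rewrite !mxE normrN normrM normrX normrN1 expr1n mulr1 ger0_norm.
pose sgn (g : 'rV[R]_n) := [ffun i => g 0 i < 0].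
have dot_sgn (g : 'rV[R]_n) : dot g (sg (sgn g)) = \sum_i `|g 0 i|.
  by apply: eq_bigr => i _; rewrite mxE ffunE normrEsign mulrC.
pose B := \sum_s `|f (x0 - r *: sg s)|.
have fub x : box r x -> f x <= B + E.
  move=> bx; have [g Hg] := supp x (K'K _ (rK' _ bx)).
  (* [dot g] is minimal over the box at this vertex, so the linear term [dot g (y - x)] is
     nonpositive for every [x] in the box. *)
  pose y := x0 - r *: sg (sgn g).
  have b_y : box r y by move=> i; rewrite addrAC subrr add0r sg_box// ltW.
  have fyB : f y <= B.
    rewrite (le_trans (ler_norm _))// /B (bigD1 (sgn g))//= lerDl.
    by apply: sumr_ge0.
  have := Hg y (K'K _ (rK' _ b_y)); have := boxE _ _ bx b_y.
  suff : dot g (y - x) <= 0 by lra.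
  have -> : y - x = - (r *: sg (sgn g)) - (x - x0) by apply/rowP => i; rewrite !mxE; ring.
  rewrite dotDr !dotNr dotZr dot_sgn.
  by have := dot_box g bx; rewrite ler_norml => /andP[+ _]; lra.
have [g0 Hg0] := supp _ Kx0.
have box0 : box r x0 by move=> i; rewrite subrr mxE normr0 ltW.
have flb x : box r x -> f x0 - E - r * \sum_i `|g0 0 i| <= f x.
  move=> bx; have := Hg0 _ (K'K _ (rK' _ bx)); have := boxE _ _ box0 bx.
  by have := dot_box g0 bx; rewrite ler_norml => /andP[_ +]; lra.
have r20 : 0 < r / 2 by rewrite divr_gt0.
have r2r : r / 2 + r / 2 = r by rewrite -splitr.
have box2 x : box (r / 2) x -> box r x.
  by move=> bx i; rewrite (le_trans (bx i))// -[leRHS]r2r lerDl ltW.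
(* Bound on the l1 norm of [gamma] over the half box: a step of [r / 2] against the signs of [gamma]
   stays in the full box, where [fub] and [flb] limit the variation of [f]. *)
pose G := (B + E + E - (f x0 - E - r * \sum_i `|g0 0 i|)) / (r / 2).
have lip x y : box (r / 2) x -> box (r / 2) y -> f x - f y <= (L + G) * enorm (x - y).
  move=> bx b_y; have [g Hg] := supp x (K'K _ (rK' _ (box2 _ bx))).
  have gG : \sum_i `|g 0 i| <= G.
    rewrite ler_pdivlMr//; pose z := x - (r / 2) *: sg (sgn g).
    have bz : box r z.
      move=> i; rewrite /z addrAC mxE -[leRHS]r2r (le_trans (ler_normD _ _))//.
      by rewrite lerD// sg_box// ltW.
    have := Hg z (K'K _ (rK' _ bz)); have := boxE _ _ (box2 _ bx) bz.
    have := fub _ bz; have := flb _ (box2 _ bx).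
    have -> : z - x = - ((r / 2) *: sg (sgn g)) by rewrite /z addrAC subrr add0r.
    rewrite dotNr dotZr dot_sgn; lra.
  have := Hg y (K'K _ (rK' _ (box2 _ b_y))).
  have := cL _ _ (rK' _ (box2 _ bx)) (rK' _ (box2 _ b_y)).
  have := dot_box g (@enorm_coord _ _ (y - x)); rewrite ler_norml => /andP[_].
  have eC : enorm (y - x) = enorm (x - y).
    by rewrite /enorm -opprB dotNl dotNr opprK.
  rewrite eC mulrDl [G * _]mulrC.
  have : enorm (x - y) * (\sum_i `|g 0 i|) <= enorm (x - y) * G.
    by rewrite ler_wpM2l// sqrtr_ge0.
  lra.
exists (box (r / 2)), (L + G); split.
  by apply/nbhs_boxP; exists (r / 2).
move=> y z _ _ b_y bz; rewrite ler_norml lip// andbT lerNl opprB.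
have eC : enorm (y - z) = enorm (z - y).
  by rewrite /enorm -opprB dotNl dotNr opprK.
by rewrite eC lip.
Qed.

End open_convex.

(** * Comparison of extended expectations *)

Section expectations.
Context (R : realType) (d : measure_display) (T : measurableType d).
Context (P : probability T R).
Local Open Scope ereal_scope.

Lemma expectation_posneg (Y : T -> R) : 'E_P[Y] = 'E_P[Y^\+] - 'E_P[Y^\-].
Proof. by rewrite unlock integralE funerpos funerneg. Qed.

Lemma ge0_expectationD (Y Z : T -> R) :
  measurable_fun setT Y -> measurable_fun setT Z ->
  (forall w, 0 <= Y w)%R -> (forall w, 0 <= Z w)%R ->
  'E_P[Y \+ Z] = 'E_P[Y] + 'E_P[Z].
Proof.
move=> mY mZ Y0 Z0; rewrite unlock; under eq_integral do rewrite EFinD.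
by rewrite ge0_integralD// => *; rewrite ?lee_fin//; exact/measurable_EFinP.
Qed.

(* Adding the negative parts to both sides leaves an inequality between
   nonnegative functions. *)
Lemma ae_expectation_le (A B Z : T -> R) :
  expectation_defined P A -> expectation_defined P B ->
  P.-integrable setT (EFin \o Z) -> 'E_P[Z] = 0 ->
  {ae P, forall w, (A w <= B w + Z w)%R} -> 'E_P[A] <= 'E_P[B].
Proof.
move=> [mA Adef] [mB Bdef] iZ Z0 AB.
have mZ : measurable_fun setT Z by apply/measurable_EFinP; exact: measurable_int iZ.
have mp (Y : T -> R) : measurable_fun setT Y -> measurable_fun setT (Y^\+)%R.
  by move=> mY; exact: measurable_funrpos.
have mn (Y : T -> R) : measurable_fun setT Y -> measurable_fun setT (Y^\-)%R.
  by move=> mY; exact: measurable_funrneg.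
have p0 (Y : T -> R) w : (0 <= Y^\+ w)%R by exact: funrpos_ge0.
have n0 (Y : T -> R) w : (0 <= Y^\- w)%R by exact: funrneg_ge0.
have : 'E_P[(A^\+ \+ B^\- \+ Z^\-)%R] <= 'E_P[(B^\+ \+ A^\- \+ Z^\+)%R].
  apply: expectation_le.
  - by apply: measurable_funD; [apply: measurable_funD|]; auto.
  - by apply: measurable_funD; [apply: measurable_funD|]; auto.
  - by move=> w; rewrite !addr_ge0.
  - by move=> w; rewrite !addr_ge0.
  move: AB; apply: filterS => w /=.
  have pn (Y : T -> R) : Y w = (Y^\+ w - Y^\- w)%R by rewrite -{1}(funrposBneg Y).
  by rewrite (pn A) (pn B) (pn Z); lra.
have E3 (u v w : T -> R) : measurable_fun setT u -> measurable_fun setT v ->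
    measurable_fun setT w -> (forall t, 0 <= u t)%R -> (forall t, 0 <= v t)%R ->
    (forall t, 0 <= w t)%R ->
    'E_P[(u \+ v \+ w)%R] = 'E_P[u] + 'E_P[v] + 'E_P[w].
  move=> mu mv mw u0 v0 w0; rewrite !ge0_expectationD//.
    exact: measurable_funD.
  by move=> t; rewrite addr_ge0.
rewrite !E3; auto.
(* Mean zero and integrability make the expectations of [Z^\+] and [Z^\-] equal and finite, so they
   cancel. *)
have fZ : 'E_P[(Z^\-)%R] \is a fin_num.
  rewrite unlock; apply: integrable_fin_num => //.
  exact: integrable_funrneg.
have fZ' : 'E_P[(Z^\+)%R] \is a fin_num.
  rewrite unlock; apply: integrable_fin_num => //.
  exact: integrable_funrpos.
have := expectation_posneg Z; rewrite Z0 => /esym/eqP.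
rewrite sube_eq ?fin_num_adde_defl// add0e => /eqP ->.
rewrite (expectation_posneg A) (expectation_posneg B).
have E0 (Y : T -> R) : (forall t, 0 <= Y t)%R -> 0 <= 'E_P[Y].
  exact: expectation_ge0.
rewrite leeD2rE//.
have := E0 _ (p0 A); have := E0 _ (n0 A); have := E0 _ (p0 B).
have := E0 _ (n0 B); move: Bdef Adef.
(* Definedness of [A] and [B] excludes a difference of two infinities. *)
case: ('E_P[(A^\+)%R]) => [ap| |]; case: ('E_P[(A^\-)%R]) => [an| |];
case: ('E_P[(B^\+)%R]) => [bp| |]; case: ('E_P[(B^\-)%R]) => [bn| |] //=;
  rewrite ?ltxx ?leey ?leNye// => -[]// _ []// _ _ _ _ _;
  rewrite -!EFinD !lee_fin; lra.
Qed.

End expectations.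

(** * Linear functionals of a bounded random variable *)

Section barycentres.
Context (R : realType) (n : nat) (d : measure_display) (T : measurableType d).
Context (P : probability T R) (X : {RV P >-> borel_rV R n}).
Context (x : 'rV[R]_n) (M : R).
Hypothesis XM : forall w, enorm (X w : 'rV[R]_n) <= M.
Hypothesis Xx : has_barycentre P X x.

Lemma measurable_coord i : measurable_fun setT (fun w => X w 0 i : R).
Proof.
pose h (v : borel_rV R n) : R := (v : 'rV[R]_n) 0 i.
suff mh : measurable_fun setT h by exact: (measurableT_comp mh).
apply: (measurability _ (RGenOInfty.measurableE R)).
move=> _ [_ [a ->] <-]; rewrite setTI; apply: sub_sigma_algebra => /=.
have -> : h @^-1` `]a, +oo[%classic = h @^-1` [set r | a < r].
  by apply/seteqP; split=> v /=; rewrite in_itv/= andbT.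
apply: open_comp; last exact: open_gt.
by move=> v _; exact: coord_continuous.
Qed.

Lemma barycentre_dot (g : 'rV[R]_n) :
  P.-integrable setT (EFin \o fun w => dot g (X w - x)) /\
  ('E_P[fun w => dot g (X w - x)] = 0)%E.
Proof.
have iX i : P.-integrable setT (EFin \o fun w => X w 0 i : R).
  apply: measurable_bounded_integrable => //.
  - by rewrite (le_lt_trans (probability_le1 P _))// ltry.
  - exact: measurable_coord.
  - exists M; split; first exact: num_real.
    move=> a Ma w _; apply: le_trans (ltW Ma).
    exact: le_trans (enorm_coord _ _) (XM w).
have iY i : P.-integrable setT (EFin \o fun w => X w 0 i - x 0 i).
  rewrite [X in integrable _ _ X](_ : _ =
    (fun w => (X w 0%R i)%:E) \- cst (x 0%R i)%:E)%E; last first.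
    by apply/funext => w /=; rewrite EFinB.
  by apply: integrableB => //; [exact: iX|exact: (finite_measure_integrable_cst P)].
have E : (fun w => (dot g (X w - x))%:E) =
    fun w => (\sum_(i < n) (g 0%R i)%:E * (X w 0%R i - x 0%R i)%R%:E)%E.
  apply/funext => w; rewrite sumEFin; congr (_%:E).
  by apply: eq_bigr => i _; rewrite !mxE.
have igY i : P.-integrable setT
    (fun w => ((g 0%R i)%:E * (X w 0%R i - x 0%R i)%R%:E)%E).
  by apply: integrableZl => //; exact: iY.
split.
  by rewrite [X in integrable _ _ X]E; apply: integrable_sum.
rewrite unlock E integral_sum// big1// => i _.
rewrite integralZl//; last exact: iY.
under eq_integral do rewrite EFinB.
rewrite integralB//; [|exact: iX|exact: (finite_measure_integrable_cst P)].
rewrite integral_cst//= probability_setT mule1.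
by have := Xx i; rewrite unlock => ->; rewrite subee// mule0.
Qed.

End barycentres.

(** * (ii) implies (iii), and (iii) implies (i) *)

Section random_variables.
Context (R : realType) (n : nat) (K : set 'rV[R]_n) (Kconvex : convex_set K).
Implicit Types (x : 'rV[R]_n).

(* The functionals [u] with [u . (X - x) = 0] almost surely form a subspace,
   spanned by the rows of [A]; the cone of directions of [K] at [x], cut by the
   kernel of [A], carries [X - x] and must be symmetric: a functional supporting
   it has zero mean along [X - x], hence belongs to that subspace. *)
Lemma ae_minimal_face (d : measure_display) (T : measurableType d)
    (P : probability T R) (X : {RV P >-> borel_rV R n}) x M :
  K x -> (forall w, enorm (X w : 'rV[R]_n) <= M) -> (forall w, K (X w)) ->
  has_barycentre P X x -> {ae P, forall w, minimal_face K x (X w)}.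
Proof.
move=> Kx XM XK Xx.
pose Y w : 'rV[R]_n := (X w : 'rV[R]_n) - x.
pose ann m (A : 'M[R]_(m, n)) := {ae P, forall w, Y w *m A^T = 0}.
have [A annA Amax] : exists2 A : 'M[R]_n, ann _ A &
    forall B : 'M[R]_n, ann _ B -> (\rank B <= \rank A)%N.
  pose p r := `[< exists2 A : 'M[R]_n, ann _ A & \rank A = r >].
  have exp : exists r, p r.
    exists 0; apply/asboolP; exists 0; last exact: mxrank0.
    by apply: aeW => w; rewrite trmx0 mulmx0.
  have pn r : p r -> (r <= n)%N by move=> /asboolP[B _ <-]; exact: rank_leq_row.
  case: (ex_maxnP exp pn) => r /asboolP[A annA Ar] rmax.
  by exists A => // B annB; rewrite Ar; apply: rmax; apply/asboolP; exists B.
(* Adjoining [l] to the rows of [A] keeps them null along [Y], so maximality of the rank puts [l] in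
   the row space. *)
have ann_sub l : ann 1 l -> (l <= A)%MS.
  move=> annl; have annAl : ann _ (A + l)%MS.
    move: annA annl; apply: filterS2 => w YA Yl.
    apply: trmx_inj; rewrite trmx_mul trmxK trmx0.
    have /sub_addsmxP[[u1 u2] ->] : ((A + l)%MS <= A + l)%MS by [].
    rewrite mulmxDl -!mulmxA; have trE m (B : 'M[R]_(m, n)) : Y w *m B^T = 0 ->
        B *m (Y w)^T = 0.
      by move=> /(congr1 trmx); rewrite trmx_mul trmxK trmx0.
    by rewrite !trE// !mulmx0 addr0.
  have le := Amax _ annAl.
  have : (A + l <= A)%MS by rewrite -(geq_leqif (mxrank_leqif_sup (addsmxSl A l))).
  exact: submx_trans (addsmxSr A l).
pose D := [set v : 'rV[R]_n | (exists2 t, 0 < t & K (x + t *: v)) /\ v *m A^T = 0].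
have YD : {ae P, forall w, D (Y w)}.
  move: annA; apply: filterS => w YA; split=> //; exists 1 => //.
  by rewrite scale1r addrC subrK.
have [||Dsym|[l [lD [v [_ vA] lv]]]] := @cone_symmetric_or_supported _ _ D.
- move=> v w [[s s0 Ks] vA] [[t t0 Kt] wA]; split; last by rewrite mulmxDl vA wA addr0.
  have st0 : 0 < s + t by rewrite addr_gt0.
  exists (s * t / (s + t)); first by rewrite divr_gt0 ?mulr_gt0.
  have -> : x + (s * t / (s + t)) *: (v + w) =
      (t / (s + t)) *: (x + s *: v) + (1 - t / (s + t)) *: (x + t *: w).
    by apply/rowP => i; rewrite !mxE; field; rewrite gt_eqF.
  apply: convex_set_combination => //; first by rewrite divr_ge0// ltW.
  by rewrite ler_pdivrMr// mul1r lerDr ltW.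
- move=> a v a0 [[s s0 Ks] vA]; split; last by rewrite -scalemxAl vA scaler0.
  exists (s / a); first by rewrite divr_gt0.
  by rewrite scalerA divfK// gt_eqF.
- move: YD; apply: filterS => w /Dsym[[t t0 Kt] _].
  apply/(minimal_faceP Kconvex) => //; split=> //; exists t => //.
  by rewrite -scalerN.
- have [intl l0] := barycentre_dot XM Xx l.
  (* [dot l (Y w)] is almost surely nonnegative with mean zero, hence almost surely zero. Then [l]
     is a combination of rows of [A], which vanish on [v], against [lv]. *)
  have : ann 1 l.
    have ldY : {ae P, forall w, 0 <= dot l (Y w)}.
      by move: YD; apply: filterS => w /lD.
    have : ae_eq P setT (fun w => (dot l (Y w))%:E) (cst 0%E).
      apply/ae_eq_integral_abs => //; first exact: measurable_int intl.
      rewrite -[RHS]l0 unlock; apply: ae_eq_integral => //.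
      - by apply: measurableT_comp => //; exact: measurable_int intl.
      - exact: measurable_int intl.
      move: ldY; apply: filterS => w lw _ /=.
      by rewrite ger0_norm.
    apply: filterS => w /(_ I)[lw].
    apply/matrixP => i j; rewrite !ord1 !mxE -[RHS]lw /dot.
    by apply: eq_bigr => k _; rewrite !mxE mulrC.
  move=> /ann_sub/submxP[z lE].
  move: lv; suff -> : dot l v = 0 by rewrite ltxx.
  have -> : dot l v = (v *m l^T) 0 0.
    by rewrite mxE; apply: eq_bigr => k _; rewrite !mxE mulrC.
  by rewrite lE trmx_mul mulmxA vA mul0mx mxE.
Qed.

Lemma random_jensen_of_face_supporting c f x :
  K x -> face_supporting K c f x -> random_jensen K c f x.
Proof.
move=> Kx [g Hg] d T P X [M XM] XK Xx fX cX.
have [iZ Z0] := barycentre_dot XM Xx g.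
apply: (ae_expectation_le fX cX iZ Z0).
have := ae_minimal_face Kx XM XK Xx.
by apply: filterS => w; exact: Hg.
Qed.

Section discrete.
Context (lam : 'I_n.+1 -> R).
Hypothesis lam0 : forall i, 0 <= lam i.
Hypothesis lam1 : \sum_i lam i = 1.

(** The law is placed on the indices, in [nat], where every set is measurable; [inord] turns an
    index back into a point. *)
Definition weighted_diracs : {measure set nat -> \bar R} :=
  msum (fun k => mscale (NngNum (lam0 (inord k))) (dirac k)) n.+1.

Lemma weighted_diracsT : weighted_diracs setT = 1%E.
Proof.
rewrite /weighted_diracs/= /msum.
transitivity (\sum_(i < n.+1) (lam (inord i))%:E)%E.
  apply: eq_bigr => i _; apply: etrans (mule1 _).
  by congr (_ * _)%E; exact: diracT.
by rewrite sumEFin; under eq_bigr do rewrite inord_val; rewrite lam1.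
Qed.

Lemma integral_weighted_diracs (h : nat -> R) :
  (\int[weighted_diracs]_w (h w)%:E = (\sum_i lam i * h i)%:E)%E.
Proof.
have ge0 (u : nat -> R) : (forall k, 0 <= u k) ->
    (\int[weighted_diracs]_w (u w)%:E = (\sum_i lam i * u i)%:E)%E.
  move=> u0; rewrite ge0_integral_measure_sum//; last by move=> *; rewrite lee_fin.
  rewrite -sumEFin; apply: eq_bigr => i _.
  rewrite ge0_integral_mscale//; last by move=> *; rewrite lee_fin.
  by rewrite integral_dirac//= diracT mul1e inord_val EFinM.
rewrite integralE.
rewrite funerpos funerneg !ge0 -?EFinB; [|exact: funrneg_ge0|exact: funrpos_ge0].
rewrite -sumrB; congr (_%:E); apply: eq_bigr => i _.
by rewrite -mulrBr -{3}(funrposBneg h).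
Qed.

End discrete.

(** On [nat] every real function is measurable and its expectation is a finite weighted sum, so both
    sides of (iii) are always meaningful. *)
Lemma finite_jensen_of_random_jensen c f x :
  random_jensen K c f x -> finite_jensen K c f x.
Proof.
move=> rand xs lam Kxs lam0 lam1 xE.
(* The mass is already one: normalising only packs the measure as a probability, and the default
   [\d_0] is never taken. *)
pose P : probability nat R := mnormalize (weighted_diracs lam0) \d_0%N.
have PE A : P A = weighted_diracs lam0 A.
  rewrite /P/= /mnormalize -/(weighted_diracs lam0) weighted_diracsT//.
  by rewrite onee_eq0/= invr1 mule1.
pose X0 (k : nat) : borel_rV R n := xs (inord k).
have mX0 : measurable_fun setT X0 by [].
pose X : {RV P >-> borel_rV R n} :=
  HB.pack X0 (isMeasurableFun.Build _ _ _ _ X0 mX0).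
have Xi (i : 'I_n.+1) : X i = xs i by rewrite /X/= /X0 inord_val.
have EP (h : nat -> R) : ('E_P[h] = (\sum_i lam i * h i)%:E)%E.
  rewrite unlock -(integral_weighted_diracs lam0).
  by apply: eq_measure_integral => A _ _; exact: PE.
have defd (h : nat -> R) : expectation_defined P h.
  by split; [|left; rewrite EP ltry].
have XM : exists M : R, forall w, enorm (X w : 'rV[R]_n) <= M.
  exists (\sum_i enorm (xs i)) => w; rewrite (bigD1 (inord w))//= lerDl.
  by apply: sumr_ge0 => j _; exact: sqrtr_ge0.
have Xx : has_barycentre P X x.
  move=> i; rewrite EP xE summxE; congr (_%:E); apply: eq_bigr => j _.
  by rewrite mxE Xi.
have := rand _ _ P X XM (fun w => Kxs _) Xx (defd _) (defd _).
rewrite !EP lee_fin -xE; congr (_ <= _); last by apply: eq_bigr => i _; rewrite Xi.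
under eq_bigr do rewrite Xi mulrBr.
by rewrite sumrB -mulr_suml lam1 mul1r.
Qed.

End random_variables.

(** * The cycle of implications, and the open case *)

Theorem theorem6p3 (R : realType) (n : nat) (K : set 'rV[R]_n)
    (c : 'rV[R]_n -> 'rV[R]_n -> R)
    (Kconvex : convex_set K)
    (ccont : {within K `*` K,
      continuous (fun p : 'rV[R]_n * 'rV[R]_n => c p.1 p.2)}) :
  (forall (x : 'rV[R]_n) (f : 'rV[R]_n -> R),
      K x -> {within K, continuous f} ->
      (finite_jensen K c f x <-> face_supporting K c f x) /\
      (face_supporting K c f x <-> random_jensen K c f x))
  /\
  (open K ->
   (forall x0, K x0 -> exists (K' : set 'rV[R]_n) (Lambda : R),
      [/\ open K', convex_set K', K' `<=` K, K' x0 &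
        forall x y, K' x -> K' y -> `|c x y| <= Lambda * enorm (x - y)]) ->
   (forall x, K x -> locally_lipschitz K (c x)) ->
   forall f : 'rV[R]_n -> R,
     (forall x, K x -> finite_jensen K c f x \/ face_supporting K c f x \/
                       random_jensen K c f x) ->
     (forall x, K x -> [/\ finite_jensen K c f x, face_supporting K c f x &
                        random_jensen K c f x]) /\
     locally_lipschitz K f).
Proof.
have equiv x f : K x ->
    (finite_jensen K c f x <-> face_supporting K c f x) /\
    (face_supporting K c f x <-> random_jensen K c f x).
  move=> Kx; have i_ii := @face_supporting_of_finite_jensen _ _ _ Kconvex c f x Kx.
  have ii_iii := @random_jensen_of_face_supporting _ _ _ Kconvex c f x Kx.
  have iii_i := @finite_jensen_of_random_jensen _ _ K c f x.
  by split; split; auto.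
split=> [x f Kx _|oK cK _ f fP]; first exact: equiv.
have face x : K x -> face_supporting K c f x.
  by move=> Kx; have [[]] := equiv x f Kx; have [|[|]] := fP x Kx; intuition.
split=> [x Kx|].
  by have [[_ ii_i] [ii_iii _]] := equiv x f Kx; have := face _ Kx; split; auto.
apply: (locally_lipschitz_of_face_supporting Kconvex oK _ face) => x0 Kx0.
have [U [L [oU _ UK Ux0 cU]]] := cK _ Kx0.
by exists U, L; split=> //; exact: open_nbhs_nbhs.
Qed.
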